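(* For each nonnegative integer $k$, the number $F(n,k)$ of positions on an $n$-column board reachable in exactly $k$ moves is given, as a function of the number $n \geq 1$ of columns, by a polynomial in $n$ of degree $k$.
   Context: A column is an infinite vertical stack of cells (with a bottom cell, and unbounded upward), and a board is a finite sequence of columns (so the columns are distinguishable). A position on a board is a placement of finitely many tokens in cells such that each token is either red or yellow, no two tokens occupy the same cell, and the occupied cells in each column form a contiguous block starting from the bottom. Equivalently, a position on an $n$-column board is an $n$-tuple of finite words over $\{R,Y\}$, each column being read from bottom to top. A reachable position is one that can be obtained from the empty board by a finite sequence of moves, where each move inserts a token into the lowest empty cell of some column, and the inserted tokens alternate globally between red and yellow from move to move, the first move placing a red token. There is no win condition. $F(n,k)$ denotes the number of positions on an $n$-column board that are reachable in exactly $k$ moves. *)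

(* Defs.v *)
From HB Require Import structures.
From mathcomp Require Import all_boot all_order.
From mathcomp Require Import finmap.

Set Implicit Arguments.
Unset Strict Implicit.
Unset Printing Implicit Defensive.

Local Open Scope fset_scope.

Inductive color : Type := Red | Yellow.

Definition is_red (c : color) : bool := if c is Red then true else false.
Definition color_of_bool (b : bool) : color := if b then Red else Yellow.

Lemma is_redK : cancel is_red color_of_bool.
Proof. by case. Qed.

HB.instance Definition _ := Countable.copy color (can_type is_redK).

(* Each column is the word of its tokens read from bottom to top, so gravity
   (no empty cell below a token) and finiteness are built in. *)
Notation position n := (n.-tuple (seq color)).

Definition empty_board (n : nat) : position n := [tuple [::] | _ < n].

Definition drop_token (n : nat) (c : color) (p : position n) (i : 'I_n)
    : position n :=
  [tuple if j == i then rcons (tnth p j) c else tnth p j | j < n].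

(* Color of the token inserted when t tokens have already been inserted. *)
Definition turn (t : nat) : color := if odd t then Yellow else Red.

Inductive reachable_in (n : nat) : nat -> position n -> Prop :=
| Reach0 : reachable_in 0 (empty_board n)
| ReachS k p i :
    reachable_in k p -> reachable_in k.+1 (drop_token (turn k) p i).

Fixpoint reachable_positions (n k : nat) : {fset position n} :=
  if k is t.+1 then
    [fset drop_token (turn t) p i | p in reachable_positions n t, i in 'I_n]
  else [fset empty_board n].

Lemma reachable_positionsP (n k : nat) (p : position n) :
  reflect (reachable_in k p) (p \in reachable_positions n k).
Proof.
apply: (iffP idP).
  elim: k p => [|k IHk] p /=; first by move/fset1P => ->; exact: Reach0.
  by case/imfset2P => q /IHk q_reach [i _ ->]; exact: ReachS.
elim=> [|{}k q i _ IHq] /=; first exact: fset11.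
by apply/imfset2P; exists q => //; exists i.
Qed.

Definition F (n k : nat) : nat := #|` reachable_positions n k|.

(* Main.v *)
(** Empty columns play no role in reachability: deleting or inserting empty
    columns turns a reachable position into a reachable one.  Sorting the
    positions by their set of nonempty columns, which has at most [k] elements,
    hence gives [F n k = \sum_(j <= k) 'C(n, j) * G j k], where [G j k] counts
    the reachable positions on [j] columns none of which is empty.  The top
    coefficient [G k k] is nonzero because [k] columns can be filled one by
    one. *)
Require Import Defs.
From mathcomp Require Import all_boot all_order all_algebra.
From mathcomp Require Import finmap.

Import GRing.Theory.
Local Open Scope ring_scope.

Set Implicit Arguments.
Unset Strict Implicit.
Unset Printing Implicit Defensive.

Definition support_of (n : nat) (p : position n) : {set 'I_n} :=
  [set i | tnth p i != [::]].

Definition restrict_along (m n : nat) (f : 'I_m -> 'I_n) (q : position n)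
    : position m :=
  [tuple tnth q (f j) | j < m].

Definition extend_along (m n : nat) (f : 'I_m -> 'I_n) (p : position m)
    : position n :=
  [tuple if [pick j | f j == i] is Some j then tnth p j else [::] | i < n].

Lemma support_of_empty_board (n : nat) : support_of (empty_board n) = set0.
Proof. by apply/setP=> i; rewrite !inE tnth_mktuple. Qed.

Lemma support_of_drop_token (n : nat) (c : color) (p : position n) (i : 'I_n) :
  support_of (drop_token c p i) = i |: support_of p.
Proof.
apply/setP=> j; rewrite !inE tnth_mktuple; have [_|_] := eqVneq j i => //.
by rewrite -size_eq0 size_rcons.
Qed.

(** Each move makes at most one further column nonempty. This bound is what truncates the sum over
    supports at size [k]. *)
Lemma card_support_of_reachable (n k : nat) (p : position n) :
  reachable_in k p -> (#|support_of p| <= k)%N.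
Proof.
elim=> [|{}k q i _ IHq]; first by rewrite support_of_empty_board cards0.
rewrite support_of_drop_token cardsU1 -add1n.
by apply: leq_add => //; case: (i \notin _).
Qed.

Section Embedding.

Variables (m n : nat) (f : 'I_m -> 'I_n).
Hypothesis f_inj : injective f.

Lemma tnth_extend_along (p : position m) (j : 'I_m) :
  tnth (extend_along f p) (f j) = tnth p j.
Proof.
rewrite tnth_mktuple; case: pickP => [j' /eqP/f_inj -> //|/(_ j)].
by rewrite eqxx.
Qed.

Lemma tnth_extend_along_out (p : position m) (i : 'I_n) :
  i \notin f @: setT -> tnth (extend_along f p) i = [::].
Proof.
move=> iNf; rewrite tnth_mktuple; case: pickP => // j /eqP fj.
by rewrite -fj imset_f in iNf.
Qed.

Lemma extend_alongK : cancel (@extend_along m n f) (restrict_along f).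
Proof.
by move=> p; apply: eq_from_tnth => j; rewrite tnth_mktuple tnth_extend_along.
Qed.

Lemma restrict_alongK (q : position n) :
  support_of q \subset f @: setT -> extend_along f (restrict_along f q) = q.
Proof.
move=> sqf; apply: eq_from_tnth => i.
have [/imsetP[j _ ->]|iNf] := boolP (i \in f @: setT).
  by rewrite tnth_extend_along tnth_mktuple.
rewrite tnth_extend_along_out //; apply/esym/eqP.
by apply: contraNT iNf => qi; apply: (subsetP sqf); rewrite inE.
Qed.

Lemma support_of_extend_along (p : position m) :
  support_of (extend_along f p) = f @: support_of p.
Proof.
apply/setP=> i; have [/imsetP[j _ ->]|iNf] := boolP (i \in f @: setT).
  by rewrite mem_imset // !inE tnth_extend_along.
rewrite inE tnth_extend_along_out //; apply/esym/negbTE.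
by apply: contra iNf; apply/subsetP/imsetS/subsetT.
Qed.

(** The same moves are replayed through [f]; the colors agree because [turn] depends only on the
    number of moves made. *)
Lemma extend_along_reachable (k : nat) (p : position m) :
  reachable_in k p -> reachable_in k (extend_along f p).
Proof.
elim=> [|{}k q i _ IHq].
  suff -> : extend_along f (empty_board m) = empty_board n by exact: Reach0.
  apply: eq_from_tnth => i; rewrite !tnth_mktuple.
  by case: pickP => // j _; rewrite tnth_mktuple.
suff -> : extend_along f (drop_token (turn k) q i)
          = drop_token (turn k) (extend_along f q) (f i) by exact: ReachS.
apply: eq_from_tnth => i'; rewrite [RHS]tnth_mktuple.
have [/imsetP[j _ ->]|i'Nf] := boolP (i' \in f @: setT).
  by rewrite !tnth_extend_along tnth_mktuple (inj_eq f_inj).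
rewrite !tnth_extend_along_out //; case: eqP => // fi.
by rewrite fi imset_f in i'Nf.
Qed.

(** Supports only grow during play, so a final support inside the image of [f] forces every move to
    be made in that image, where it pulls back along [f]. *)
Lemma restrict_along_reachable (k : nat) (q : position n) :
    support_of q \subset f @: setT ->
  reachable_in k q -> reachable_in k (restrict_along f q).
Proof.
move=> + q_reach; elim: q_reach => [_|{}k p i _ IHp].
  suff -> : restrict_along f (empty_board n) = empty_board m by exact: Reach0.
  by apply: eq_from_tnth => j; rewrite !tnth_mktuple.
rewrite support_of_drop_token subUset sub1set => /andP[/imsetP[j _ ->] /IHp].
suff -> : restrict_along f (drop_token (turn k) p (f j))
          = drop_token (turn k) (restrict_along f p) j by exact: ReachS.
by apply: eq_from_tnth => j'; rewrite !tnth_mktuple (inj_eq f_inj).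
Qed.

End Embedding.

Definition positions_with_support (n k : nat) (A : {set 'I_n})
    : {fset position n} :=
  [fset p in reachable_positions n k | support_of p == A]%fset.

(** This is the number [G j k] of the overview. *)
Definition full_count (j k : nat) : nat :=
  #|` positions_with_support k [set: 'I_j]|%fset.

(** Enumerating [A] gives an injection of ['I_#|A|] with image [A]; extension along it is a
    bijection that preserves reachability in both directions. *)
Lemma card_positions_with_support (n k : nat) (A : {set 'I_n}) :
  #|` positions_with_support k A|%fset = full_count #|A| k.
Proof.
pose f := @enum_val _ (mem A); have f_inj : injective f := @enum_val_inj _ _.
have imf : f @: setT = A.
  apply/setP=> i; apply/imsetP/idP => [[j _ ->]|iA]; first exact: enum_valP.
  by exists (enum_rank_in iA i); rewrite // /f enum_rankK_in.
suff -> : positions_with_support k A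
    = (extend_along f @` positions_with_support k [set: 'I_#|A|])%fset.
  by rewrite card_imfset //; apply: can_inj (extend_alongK f_inj).
apply/fsetP=> q; apply/idP/imfsetP => /= [|[p + ->]].
  rewrite !inE => /andP[/reachable_positionsP q_reach /eqP sq].
  have sqf : support_of q \subset f @: setT by rewrite imf sq.
  exists (restrict_along f q); last by rewrite restrict_alongK.
  rewrite !inE; apply/andP; split.
    exact/reachable_positionsP/restrict_along_reachable.
  (* Both supports are compared after pushing them forward along [f], where extension undoes
     restriction. *)
  apply/eqP/(imset_inj f_inj).
  by rewrite -support_of_extend_along // restrict_alongK // imf.
rewrite !inE => /andP[/reachable_positionsP p_reach /eqP sp].
apply/andP; split; first exact/reachable_positionsP/extend_along_reachable.
by rewrite support_of_extend_along // sp imf.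
Qed.

Lemma F_sum_binomial (n k : nat) :
  F n k = (\sum_(j < k.+1) 'C(n, j) * full_count j k)%N.
Proof.
rewrite /F -sum1_size big_seq.
rewrite (partition_big (@support_of n) (fun A => #|A| < k.+1)%N) /=; last first.
  by move=> p /reachable_positionsP; exact: card_support_of_reachable.
(* The supports are now grouped by size; [inord] is faithful here since only sets of size at most
   [k] remain. *)
rewrite (partition_big (fun A : {set 'I_n} => inord #|A| : 'I_k.+1) predT) //=.
apply: eq_bigr => j _.
(* The binomial coefficient becomes a sum over the subsets of size [j], to be matched with the
   supports one by one. *)
rewrite -[n in 'C(n, _)]card_ord -card_draws -sum1_card big_distrl /=.
apply: eq_big => [A|A /andP[Ak /eqP <-]].
  rewrite inE; apply/andP/eqP => [[Ak /eqP <-]|Aj]; first by rewrite inordK.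
  by rewrite Aj inord_val.
rewrite mul1n inordK // -card_positions_with_support -big_seq_cond.
rewrite sum1_count -size_filter; apply: perm_size; apply: uniq_perm.
- exact: filter_uniq (fset_uniq _).
- exact: fset_uniq.
by move=> p; rewrite mem_filter !inE andbC.
Qed.

Lemma full_count_diag_gt0 (k : nat) : (0 < full_count k k)%N.
Proof.
(* The position after [t] moves when move number [i], counted from 0, is made in column [i]. *)
pose q t : position k :=
  [tuple if (i < t)%N then [:: turn i] else [::] | i < k].
have q_reach t : (t <= k)%N -> reachable_in t (q t).
  elim: t => [_|t IHt ltk].
    suff -> : q 0%N = empty_board k by exact: Reach0.
    by apply: eq_from_tnth => i; rewrite !tnth_mktuple.
  suff -> : q t.+1 = drop_token (turn t) (q t) (Ordinal ltk).
    exact/ReachS/IHt/ltnW.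
  apply: eq_from_tnth => i; rewrite !tnth_mktuple ltnS -val_eqE /=.
  by case: ltngtP => // ->.
rewrite cardfs_gt0; apply/fset0Pn; exists (q k); rewrite !inE; apply/andP.
split; first exact/reachable_positionsP/q_reach.
by apply/eqP/setP=> i; rewrite !inE tnth_mktuple ltn_ord.
Qed.

Definition binomial_poly (j : nat) : {poly rat} :=
  (j`!%:R)^-1 *: \prod_(i < j) ('X - i%:R%:P).

Lemma fact_neq0 (j : nat) : j`!%:R != 0 :> rat.
Proof. by rewrite Num.Theory.pnatr_eq0 -lt0n fact_gt0. Qed.

Lemma horner_binomial_poly (j n : nat) : (binomial_poly j).[n%:R] = 'C(n, j)%:R.
Proof.
have ffactE : (\prod_(i < j) ('X - i%:R%:P)).[n%:R] = (n ^_ j)%:R :> rat.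
  elim: j => [|j IHj]; first by rewrite big_ord0 hornerC.
  rewrite big_ord_recr /= hornerM IHj hornerXsubC ffactnSr natrM.
  (* Subtraction on [nat] truncates, unlike on [rat]; when [n < j] the factor [n ^_ j] is already
     zero, so both sides vanish. *)
  have [lejn|ltnj] := leqP j n; first by rewrite natrB.
  by rewrite ffact_small // !mul0r.
by rewrite hornerZ ffactE -bin_ffact natrM mulrC mulfK ?fact_neq0.
Qed.

Lemma size_binomial_poly (j : nat) : size (binomial_poly j) = j.+1.
Proof.
rewrite size_scale ?invr_eq0 ?fact_neq0 // size_prod_XsubC.
by rewrite /index_enum -enumT size_enum_ord.
Qed.

Theorem theorem1 (k : nat) :
  exists P : {poly rat},
    size P = k.+1 /\ forall n : nat, (1 <= n)%N -> (F n k)%:R = P.[n%:R].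
Proof.
exists (\sum_(j < k.+1) (full_count j k)%:R *: binomial_poly j); split.
  have top_neq0 : (full_count k k)%:R != 0 :> rat.
    by rewrite Num.Theory.pnatr_eq0 -lt0n full_count_diag_gt0.
  (* The term [j = k] has size [k.+1] and all others together have size at most [k], so the leading
     term cannot cancel. *)
  rewrite big_ord_recr /= addrC size_polyDl size_scale // size_binomial_poly //.
  rewrite ltnS; apply: (leq_trans (size_sum _ _ _)); apply/bigmax_leqP => j _.
  by rewrite (leq_trans (size_scale_leq _ _)) // size_binomial_poly.
move=> n _; rewrite F_sum_binomial natr_sum horner_sum; apply: eq_bigr => j _.
by rewrite hornerZ horner_binomial_poly natrM mulrC.
Qed.
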